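(* Let $R$ be a principal ideal ring (not necessarily an integral domain) and let $A\in \mathrm{M}_n(R)$, $n\geq 2$, be a matrix with trace zero. Then $A=[X,Y]$ for some $X,Y\in \mathrm{M}_n(R)$.
   Context: All rings are commutative with identity; a principal ideal ring is a ring in which every ideal is principal. $\mathrm{M}_n(R)$ is the ring of $n\times n$ matrices over $R$, and $[X,Y]=XY-YX$. *)

(* Defs.v *)
From mathcomp Require Import all_boot all_algebra.

Set Implicit Arguments.
Unset Strict Implicit.
Unset Printing Implicit Defensive.

Import GRing.Theory.

Local Open Scope ring_scope.

(* ring_quotient's [idealr] covers only decidable ideals not containing 1;
   here ideals are arbitrary Prop-valued subsets, the unit ideal included. *)
Definition is_ideal (R : comPzRingType) (I : R -> Prop) : Prop :=
  [/\ I 0,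
      forall x y : R, I x -> I y -> I (x + y)
    & forall a x : R, I x -> I (a * x)].

Definition is_principal (R : comPzRingType) (I : R -> Prop) : Prop :=
  exists d : R, forall x : R, I x <-> exists c : R, x = c * d.

Definition principal_ideal_ring (R : comPzRingType) : Prop :=
  forall I : R -> Prop, is_ideal I -> is_principal I.

(* Main.v *)
Require Import Defs.
From mathcomp Require Import all_boot all_algebra.
From mathcomp Require Import ring zify.

Set Implicit Arguments.
Unset Strict Implicit.
Unset Printing Implicit Defensive.

Import GRing.Theory.

Local Open Scope ring_scope.

(** Conjugate A to a lower Hessenberg matrix. The matrix X is sought lower
    triangular with three nonzero diagonals ([staircase]): main diagonal
    0, x, 0, x, ..., subdiagonal y_0, y_1, ..., and a second subdiagonal tuned
    so that T = X^2 - x X has ones on its second subdiagonal and zeros above it.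
    Three facts make this shape work.

    - Since X^(r+2) = x X^(r+1) + X^r T and tr (X^r T A) = 0 for Hessenberg A,
      the conditions tr (X^r A) = 0 for all r reduce to tr A = 0 and the single
      linear equation tr (X A) = 0.

    - These trace conditions are also sufficient. For every c, the vectors
      v, X v, T v, X T v, T^2 v, ... with v = e_0 + c e_1 form a triangular
      matrix K with diagonal 1, y_0 + c x, 1, y_0 + c x, ... and X K = K C for
      a bidiagonal C with ones on the subdiagonal. For such a C the trace
      conditions characterise the commutators [C, Y] (solve for the rows of Y
      from the bottom up), so some power of y_0 + c x times A is of the form
      [X, Y]. Take c = 0 and c = 1: since y_0 and x are comaximal, so are
      y_0 and y_0 + x, and A itself is of this form. In general X is
      similar to C only after localisation, which is why two values
      of c are needed.

    - The second subdiagonal exists if and only if y_i y_(i+1) = 1 modulo x for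
      all i, so tr (X A) = 0 has to be solved under these congruences. Divide
      the entries a_i above the diagonal of A by their common divisor g, and
      then divide g and the sum t of the odd diagonal entries by their common
      divisor. Up to the multiples of x, which can be distributed freely among
      the y_i, what is left is a system in five unknowns ([balanced]).

    The system is solved over any principal ideal ring. An idempotent
    splits a given element into a nilpotent and a regular part
    ([idempotent_split]). This replaces the decomposition of the ring into
    domains and local Artinian rings, and gives gcds with comaximal cofactors
    ([gcd_cofactors]), a translate of one element comaximal to a regular one
    ([comaximal_translate]), and the divisibility of nilpotent elements by
    regular ones ([nilpotent_absorbs_regular]). The gcds with comaximal
    cofactors are also what the reduction to Hessenberg form uses. *)

(** * Comaximal, nilpotent and regular elements *)

Section Coprimality.
Variable R : comPzRingType.
Implicit Types a b c e : R.

Definition comaximal a b := exists u v : R, u * a + v * b = 1.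
Definition nilpotent a := exists k : nat, a ^+ k = 0.
Definition regular a := forall x : R, a * x = 0 -> x = 0.

Lemma comaximal_sym a b : comaximal a b -> comaximal b a.
Proof. by case=> u [v h]; exists v, u; rewrite addrC. Qed.

Lemma comaximalMr a b c :
  comaximal a b -> comaximal a c -> comaximal a (b * c).
Proof.
move=> [u [v h]] [u' [v' h']].
exists (u * u' * a + u * v' * c + v * b * u'), (v * v').
by rewrite -[RHS]mulr1 -{1}h -h'; ring.
Qed.

Lemma comaximalXr a b k : comaximal a b -> comaximal a (b ^+ k).
Proof.
move=> h; elim: k => [|k IH]; first by exists 0, 1; rewrite expr0; ring.
by rewrite exprS; apply: comaximalMr.
Qed.

Lemma comaximal_dvdr a b c : comaximal a (b * c) -> comaximal a b.
Proof. by move=> [u [v h]]; exists u, (v * c); rewrite -h; ring. Qed.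

Lemma unit_1sub_nilpotent a : nilpotent a -> exists v, v * (1 - a) = 1.
Proof.
move=> [k h]; have := subrX1 a k; rewrite h => E.
exists (\sum_(i < k) a ^+ i); rewrite -[RHS]opprK -[- 1]add0r E; ring.
Qed.

Lemma nilpotentM a b : nilpotent a -> nilpotent (b * a).
Proof. by move=> [k h]; exists k; rewrite exprMn h mulr0. Qed.

Lemma regular_dvd a b : regular (a * b) -> regular a.
Proof. by move=> h x hx; apply: h; rewrite mulrAC hx mul0r. Qed.

Lemma regularX a k : regular a -> regular (a ^+ k).
Proof.
move=> ha; elim: k => [|k IH] x; first by rewrite mul1r.
by rewrite exprS -mulrA => /ha /IH.
Qed.

Lemma nilpotent_regular_quotient a b :
  regular b -> nilpotent (a * b) -> nilpotent a.
Proof.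
move=> hb [k]; rewrite exprMn mulrC => h.
by exists k; apply: (regularX hb h).
Qed.

End Coprimality.

(** * Arithmetic in a principal ideal ring *)

Section PIR.
Variable R : comPzRingType.
Hypothesis hR : principal_ideal_ring R.
Implicit Types a b c e : R.

Lemma pair_principal a b :
  exists d a' b' u v : R, [/\ a = a' * d, b = b' * d & d = u * a + v * b].
Proof.
have [|d hd] := hR (I := fun x => exists u v, x = u * a + v * b).
  split; first by exists 0, 0; ring.
  - move=> x y [u [v ->]] [u' [v' ->]].
    by exists (u + u'), (v + v'); ring.
  - by move=> c x [u [v ->]]; exists (c * u), (c * v); ring.
have /hd[a' ha] : exists u v, a = u * a + v * b by exists 1, 0; ring.
have /hd[b' hb] : exists u v, b = u * a + v * b by exists 0, 1; ring.
have /hd[u [v hu]] : exists c, d = c * d by exists 1; ring.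
by exists d, a', b', u, v.
Qed.

(** The saturation of (b) with respect to a is an ideal, and a generator of it
    is multiplied into (b) by a single power of a. This is the only form in
    which the ascending chain condition is used; b = 0 gives the annihilator of
    all large powers of a. *)
Lemma saturation a b :
  exists (w : R) (k : nat), (exists c, w * a ^+ k = b * c) /\
    forall z j c, z * a ^+ j = b * c -> exists s, z = s * w.
Proof.
have [|w hw] := hR (I := fun z => exists k c, z * a ^+ k = b * c).
  split; first by exists 0, 0; ring.
  - move=> x y [k [c h]] [l [d h']].
    exists (k + l)%N, (c * a ^+ l + d * a ^+ k).
    rewrite exprD mulrDl [x * _]mulrA h mulrCA mulrC h'; ring.
  - move=> c x [k [d h]]; exists k, (c * d).
    by rewrite -mulrA h; ring.
have /hw[k [c h]] : exists c, w = c * w by exists 1; ring.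
exists w, k; split; first by exists c.
move=> z j c' hz; have /hw[s ->] : exists k c, z * a ^+ k = b * c.
  by exists j, c'.
by exists s.
Qed.

(** Let (c) be the annihilator of all large powers of a, and N one of these
    powers. Write the ideal (N, c) as (d), with N = n d and c = g d. The defect
    w of the cofactors satisfies d w = 0, so w kills N and c; it therefore
    lies in (c) and has square zero, and (n, g) is the unit ideal. Now
    N^2 g = n N c = 0 puts g in (c), whence n g = 0: the ring is the product of
    the parts on which n, respectively g, vanishes, and the idempotent
    e generates (c). *)
Lemma idempotent_split a : exists e,
  [/\ e * e = e, nilpotent (e * a) & regular (e + (1 - e) * a)].
Proof.
have [c [k [[c' ]]]] := saturation a 0; rewrite mul0r => hc hmax.
pose N := a ^+ k; have hNc : N * c = 0 by rewrite mulrC.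
have {}hmax z j : a ^+ j * z = 0 -> exists s, z = s * c.
  by move=> hz; apply: (hmax z j 0); rewrite mul0r mulrC.
have [d [n [g [u [v [hN hg hd]]]]]] := pair_principal N c.
pose w := 1 - n * u - g * v.
have hdw : d * w = 0.
  have -> : d * w = d - u * (n * d) - v * (g * d) by rewrite /w; ring.
  by rewrite -hN -hg {1}hd; ring.
have [s hs] : exists s, w = s * c.
  by apply: (hmax _ k); rewrite -/N hN -mulrA hdw mulr0.
have hww : w * w = 0 by rewrite {1}hs hg -!mulrA hdw !mulr0.
have hone : (1 + w) * (n * u + g * v) = 1.
  have -> : n * u + g * v = 1 - w by rewrite /w; ring.
  by rewrite mulrBr mulr1 mulrDl hww mul1r addr0 addrK.
have [t ht] : exists t, g = t * c.
  apply: (hmax _ (k + k)%N); rewrite exprD -/N.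
  have -> : N * N * g = N * (n * (g * d)) by rewrite {2}hN; ring.
  by rewrite -hg mulrCA hNc mulr0.
have hNg : N * g = 0 by rewrite ht mulrCA hNc mulr0.
have hng : n * g = 0.
  rewrite ht {1}hg.
  have -> : n * (t * (g * d)) = t * ((n * d) * g) by ring.
  by rewrite -hN hNg mulr0.
pose e := g * v * (1 + w).
have he1 : 1 - e = n * u * (1 + w) by rewrite -[X in X - e]hone /e; ring.
have hen : e * (1 - e) = 0.
  rewrite he1 /e.
  have -> : g * v * (1 + w) * (n * u * (1 + w)) =
            n * g * (v * u * (1 + w) ^+ 2) by ring.
  by rewrite hng mul0r.
have hee : e * e = e.
  by apply/esym/eqP; rewrite -subr_eq0 -{1}[e]mulr1 -mulrBr hen.
exists e; split=> //.
  exists k.+1; rewrite exprMn exprSr [a ^+ _]exprSr -/N.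
  have -> : e ^+ k * e * (N * a) = e ^+ k * a * v * (1 + w) * (N * g).
    by rewrite {2}/e; ring.
  by rewrite hNg mulr0.
move=> x hx.
have hex : e * x = 0.
  have : e * ((e + (1 - e) * a) * x) = 0 by rewrite hx mulr0.
  have -> : e * ((e + (1 - e) * a) * x) = (e * e + e * (1 - e) * a) * x.
    by ring.
  by rewrite hen hee mul0r addr0.
have hax : a ^+ 1 * x = 0.
  rewrite expr1 -hx.
  have -> : (e + (1 - e) * a) * x = a * x + (1 - a) * (e * x) by ring.
  by rewrite hex mulr0 addr0.
have [r hr] := hmax _ _ hax.
have -> : x = e * x + (1 - e) * x by ring.
rewrite hex add0r he1 hr hg.
have -> : n * u * (1 + w) * (r * (g * d)) = n * g * (u * (1 + w) * r * d).
  by ring.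
by rewrite hng mul0r.
Qed.

(** Cofactors of a generator d of (a, b) are comaximal up to an element w with
    d w = 0. Split w: where it is regular, d vanishes and the cofactors may be
    replaced by 1 and 0; where it is nilpotent they are already comaximal. *)
Lemma gcd_cofactors a b :
  exists d a' b' : R, [/\ a = d * a', b = d * b' & comaximal a' b'].
Proof.
have [d [a' [b' [u [v [ha hb hd]]]]]] := pair_principal a b.
pose w := 1 - (u * a' + v * b').
have hdw : d * w = 0.
  have -> : d * w = d - (u * (a' * d) + v * (b' * d)) by rewrite /w; ring.
  by rewrite -ha -hb -hd subrr.
have [e [hee hnil hreg]] := idempotent_split w.
have hde : d * e = d.
  have : (1 - e) * d = 0.
    apply: hreg; have -> : (e + (1 - e) * w) * ((1 - e) * d) =
      (e - e * e) * d + (1 - e) * (1 - e) * (d * w) by ring.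
    by rewrite hee subrr hdw mulr0 mul0r addr0.
  by rewrite mulrBl mul1r mulrC => /eqP; rewrite subr_eq0 => /eqP.
exists d, (a' * e + (1 - e)), (b' * e); split.
- have -> : d * (a' * e + (1 - e)) = a' * (d * e) + (d - d * e) by ring.
  by rewrite hde subrr addr0.
- by rewrite mulrCA hde.
have [q hq] := unit_1sub_nilpotent hnil.
exists (q * (u * e + (1 - e))), (q * (v * e)); rewrite -[RHS]hq.
have -> : 1 - e * w = (u * a' + v * b' + 1 - e) * e + (1 - e)
             + (1 - u * a' - v * b') * (e * e - e).
  by rewrite /w; ring: hee.
by rewrite /w hee; ring: hee.
Qed.

(** The multiplier w is the largest divisor of P that is comaximal to a. Since
    P divides w a^k, a prime dividing P divides a or w, and not both; hence it
    divides exactly one of the two summands of a + b w, because a and b are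
    comaximal. *)
Lemma comaximal_translate P a b : regular P -> comaximal a b ->
  exists w, comaximal (a + b * w) P.
Proof.
move=> hP hab.
have [w [k [[t ht] hmax]]] := saturation a P.
have [f hf] : exists f, P = f * w by apply: (hmax _ 0%N 1); rewrite expr0.
have hw : regular w by apply: (@regular_dvd _ _ f); rewrite mulrC -hf.
have [d [w' [a' [wE aE hwa]]]] := gcd_cofactors w a.
have [s hs] : exists s, w' = s * w.
  apply: (hmax _ k.+1 (t * a')).
  have -> : w' * a ^+ k.+1 = d * w' * a ^+ k * a'.
    by rewrite exprSr {2}aE; ring.
  by rewrite -wE ht; ring.
have hd : s * d = 1.
  apply/eqP; rewrite -subr_eq0; apply/eqP; apply: hw.
  have -> : w * (s * d - 1) = d * (s * w) - w by ring.
  by rewrite -hs -wE subrr.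
have hwaC : comaximal w a.
  case: hwa => u [v h]; exists (s * u), (s * v).
  rewrite wE aE -[RHS]hd -[in RHS](mulr1 d) -h; ring.
exists w.
apply: (@comaximal_dvdr _ _ _ t); rewrite -ht.
apply: comaximalMr.
  case: hwaC => u [v h]; exists v, (u - v * b); rewrite -h; ring.
apply: comaximalXr.
have [u [v h]] : comaximal a (b * w).
  by apply: comaximalMr => //; apply: comaximal_sym.
by exists v, (u - v); rewrite -h; ring.
Qed.

(** In (a, b) = (d) the cofactor of the nilpotent a is nilpotent because d is
    regular, so the cofactor of b is a unit. *)
Lemma regular_dvd_nilpotent a b : nilpotent a -> regular b ->
  exists c, a = b * c.
Proof.
move=> ha hb.
have [d [b' [a' [bE aE [u [v h]]]]]] := gcd_cofactors b a.
have hd : regular d by apply: (@regular_dvd _ _ b'); rewrite -bE.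
have /(nilpotentM v)/unit_1sub_nilpotent[q hq] : nilpotent a'.
  by apply: (nilpotent_regular_quotient hd); rewrite mulrC -aE.
exists (q * u * a'); rewrite aE bE.
have -> : d * b' * (q * u * a') = q * (u * b') * (d * a') by ring.
by have -> : u * b' = 1 - v * a'; [rewrite -h; ring | rewrite hq mul1r].
Qed.

(** The saturation (w) of (a) with respect to b is again nilpotent, hence w = b c;
    then c lies in the saturation too, so that (w) = b (w). *)
Lemma nilpotent_absorbs_regular a b : nilpotent a -> regular b ->
  exists s, a = b * s * a.
Proof.
move=> ha hb.
have [w [k [[t ht] hmax]]] := saturation b a.
have hw : nilpotent w.
  apply: (nilpotent_regular_quotient (regularX hb) (b := b ^+ k)).
  by rewrite ht mulrC; apply: nilpotentM.
have [c hc] := regular_dvd_nilpotent hw hb.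
have [s hs] : exists s, c = s * w.
  by apply: (hmax _ k.+1 t); rewrite -ht hc exprS; ring.
have [f hf] : exists f, a = f * w by apply: (hmax _ 0%N 1); rewrite expr0.
exists s; rewrite {1}hf hc hs hf; ring.
Qed.

(** The linear condition on the staircase matrix, with diagonal parameter b x and
    subdiagonal y', y, y', y, ... up to multiples of b x: here P and Q stand for
    the weights of y' and y, and t for the weight of the diagonal. *)
Definition balanced P Q t b := exists x y y' z k : R,
  y * y' = 1 + b * x * z /\ x * (t + b * k) + y' * P + y * Q = 0.

Lemma balanced_sym P Q t b : balanced P Q t b -> balanced Q P t b.
Proof.
move=> [x [y [y' [z [k [h1 h2]]]]]]; exists x, y', y, z, k.
by split; [rewrite mulrC | rewrite -h2; ring].
Qed.

(** Solvability is local on the two factors determined by an idempotent, since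
    [balanced] is given by polynomial equations. *)
Lemma balanced_glue e P Q t b P' Q' t' b' : e * e = e ->
  balanced P Q t b -> balanced P' Q' t' b' ->
  balanced (e * P + (1 - e) * P') (e * Q + (1 - e) * Q')
           (e * t + (1 - e) * t') (e * b + (1 - e) * b').
Proof.
move=> hee.
pose mix u v := e * u + (1 - e) * v.
have mixM u v u' v' : mix u v * mix u' v' = mix (u * u') (v * v').
  by rewrite /mix; ring: hee.
have mixD u v u' v' : mix u v + mix u' v' = mix (u + u') (v + v').
  by rewrite /mix; ring.
have mixC u : u = mix u u by rewrite /mix; ring.
move=> [x [y [y1 [z [k [h1 h2]]]]]] [x' [y' [y1' [z' [k' [h1' h2']]]]]].
exists (mix x x'), (mix y y'), (mix y1 y1'), (mix z z'), (mix k k').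
rewrite -!/(mix _ _); split.
  by rewrite [1]mixC !mixM mixD h1 h1'.
by rewrite [0]mixC !(mixM, mixD) h2 h2'.
Qed.

(** Choose y to be an inverse of t modulo b that is comaximal to P; then
    x = - (P + y^2 Q) is comaximal to y as well, so y has an inverse y' modulo
    b x. Multiplying the equation by y, it reads x (t + b k) y = x modulo b x,
    which holds for a suitable k because t y = 1 modulo b. *)
Lemma balanced_regular P Q t b :
  regular P -> comaximal t b -> balanced P Q t b.
Proof.
move=> hP [a [c h]].
have [w hw] : exists w, comaximal (a + b * w) P.
  by apply: comaximal_translate => //; exists t, c; rewrite -h; ring.
set y := a + b * w in hw; pose x := - (P + y ^+ 2 * Q).
have hyx : comaximal y x.
  by case: hw => u [v hu]; exists (u - v * y * Q), (- v); rewrite -hu /x; ring.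
have hyb : comaximal y b by exists t, (c - w * t); rewrite -h /y; ring.
have [y' [z hz]] := comaximalMr hyb hyx.
have {}hz : y * y' = 1 - b * x * z by rewrite -hz; ring.
exists x, y, y', (- z), (y' * (c - w * t) - t * x * z - z * y * Q); split.
  by rewrite hz; ring.
(* uses 1 = t y + b (c - w t) and y y' = 1 - b x z *)
have hk : t + b * (y' * (c - w * t) - t * x * z - z * y * Q)
        = y' - b * z * y * Q.
  have hy : y' = t * (1 - b * x * z) + b * (y' * (c - w * t)).
    by rewrite -hz -[LHS]mulr1 -h /y; ring.
  by rewrite [X in _ = X - _]hy; ring.
rewrite hk.
have -> : x * (y' - b * z * y * Q) + y' * P + y * Q =
   y' * (x + P) + y * Q * (1 - b * x * z) by ring.
rewrite -hz /x; ring.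
Qed.

(** By idempotents it is enough to treat P regular, Q regular, and both
    nilpotent. In the last case take y = y' = 1: the nilpotent W = P + Q
    satisfies W = b s W, so modulo the annihilator of W the element b is
    a unit and t + b k can be made equal to 1, and x = - W works. *)
Lemma balanced_regular_modulus P Q t b : regular b -> comaximal t b ->
  balanced P Q t b.
Proof.
move=> hb htb.
have [e [hee hPn hPr]] := idempotent_split P.
have [f [hff hQn hQr]] := idempotent_split Q.
have hmix (g u : R) : u = g * u + (1 - g) * u by ring.
have mixE (g u : R) : g * g = g ->
    u = g * (g * u) + (1 - g) * (g + (1 - g) * u).
  by move=> hg; ring: hg.
rewrite [P](mixE e) // [Q](hmix e) [t](hmix e) [b](hmix e).
apply: balanced_glue => //; last exact: balanced_regular.
rewrite [e * P](hmix f) [Q](mixE f) // [t](hmix f) [b](hmix f).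
apply: balanced_glue => //.
  have : nilpotent (e * P + f * Q).
    move: hPn hQn => [k hk] [l hl]; exists (k + l)%N.
    rewrite exprDn big1 // => i _.
    have [hi|hi] := leqP l i.
      by rewrite -(subnK hi) [_ ^+ (_ + l)]exprD hl !mulr0 mul0rn.
    have hki : (k <= k + l - i)%N by rewrite -addnBA ?leq_addr // ltnW.
    by rewrite -(subnK hki) exprD hk mulr0 mul0r mul0rn.
  move=> /nilpotent_absorbs_regular/(_ hb)[s hs].
  exists (- (e * P + f * Q)), 1, 1, 0, (s * (1 - t)); split; first by ring.
  have -> : - (e * P + f * Q) * (t + b * (s * (1 - t))) +
      1 * (e * P) + 1 * (f * Q)
    = (1 - t) * ((e * P + f * Q) - b * s * (e * P + f * Q)) by ring.
  by rewrite -hs subrr mulr0.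
by apply/balanced_sym/balanced_regular.
Qed.

(** Where b is nilpotent t is a unit, and y = 1 / t, y' = t, k = 0 will do. *)
Lemma balanced_comaximal P Q t b : comaximal t b -> balanced P Q t b.
Proof.
move=> [u [v h]].
have [e [hee hnil hreg]] := idempotent_split b.
have hmix (r : R) : r = e * r + (1 - e) * r by ring.
have -> : b = e * (e * b) + (1 - e) * (e + (1 - e) * b) by ring: hee.
have -> : t = e * (e * t + (1 - e)) + (1 - e) * t by ring: hee.
rewrite [P]hmix [Q]hmix; apply: balanced_glue => //; last first.
  apply: balanced_regular_modulus => //.
  exists ((1 - e) * u), ((1 - e) * v + e).
  have -> : (1 - e) * u * t = (1 - e) * (1 - v * b) by rewrite -h; ring.
  by ring: hee.
have /(nilpotentM v)/unit_1sub_nilpotent[q hq] := hnil.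
pose y := q * (u * e + (1 - e)).
have hy : y * (e * t + (1 - e)) = 1.
  rewrite -[RHS]hq; have -> : v * (e * b) = e * (1 - u * t) by rewrite -h; ring.
  by rewrite /y; ring: hee.
clearbody y; exists (- (P + y ^+ 2 * Q)), y, (e * t + (1 - e)), 0, 0.
split; first by rewrite hy; ring.
have -> : forall r, - (P + y ^+ 2 * Q) * (r + e * b * 0) + r * P + y * Q =
   y * Q * (1 - y * r) by move=> r; ring.
by rewrite hy subrr mulr0.
Qed.

End PIR.

(** * Commutators with a bidiagonal matrix *)

Section Companion.
Variable R : comPzRingType.

Definition bidiagonal m (d : nat -> R) : 'M[R]_m.+1 :=
  \matrix_(i, j) (d j *+ (i == j) + (i == j.+1 :> nat)%:R).

Lemma mulmx_bidiagonal m p (d : nat -> R) (Z : 'M[R]_(p, m.+1)) i j :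
  (Z *m bidiagonal m d) i j =
    Z i j * d j + (if (j.+1 < m.+1)%N then Z i (inord j.+1) else 0).
Proof.
rewrite mxE; under eq_bigr do rewrite mxE mulrDr.
rewrite big_split /= (bigD1 j) //= eqxx mulr1n big1 ?addr0; last first.
  by move=> k /negbTE->; rewrite mulr0n mulr0.
congr (_ + _); case: ifP => hj.
  rewrite (bigD1 (inord j.+1)) //= inordK // eqxx mulr1 big1 ?addr0 // => k.
  move=> /eqP hk; case: eqP => [hkj|]; last by rewrite mulr0.
  by case: hk; apply/val_inj; rewrite /= inordK.
rewrite big1 // => k _; case: eqP => [hkj|]; last by rewrite mulr0.
by move: (ltn_ord k); rewrite hkj hj.
Qed.

(** Comparing row i + 1 of B and C Y - Y C gives row i of Y in terms of row i + 1.
    So Y can be chosen such that B - (C Y - Y C) has only its row 0, say w. The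
    trace conditions say that w C^r e_0 = 0 for all r, and since
    e_(j+1) = C e_j - d_j e_j the vector e_0 is cyclic for C, so w = 0. *)
Lemma commutator_bidiagonal m (d : nat -> R) (B : 'M[R]_m.+1) :
  (forall r, \tr (bidiagonal m d ^+ r *m B) = 0) ->
  exists Y, B = bidiagonal m d *m Y - Y *m bidiagonal m d.
Proof.
set C := bidiagonal m d => htr.
(* y k is the row of index m - k of Y *)
pose y := fix y k := if k is k'.+1 then
    row (inord (m - k')) B - d (m - k')%N *: y k' + y k' *m C else 0.
pose Y : 'M[R]_m.+1 := \matrix_(i, j) y (m - i)%N 0 j.
exists Y; set Z := _ - _.
have rowY i : row i Y = y (m - i)%N.
  by apply/rowP=> j; rewrite !mxE.
have rowC (i : 'I_m.+1) : row i (C *m Y) = d i *: row i Y +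
    (if (0 < i)%N then row (inord i.-1) Y else 0).
  apply/rowP=> j; rewrite !mxE; under eq_bigr do rewrite mxE mulrDl.
  rewrite big_split /= (bigD1 i) //= eqxx mulr1n big1 ?addr0; last first.
    by move=> k; rewrite eq_sym => /negbTE->; rewrite mulr0n mul0r.
  rewrite !mxE; congr (_ + _); case: ifP => hi.
    have hi1 : (i.-1 < m.+1)%N by have := ltn_ord i; lia.
    rewrite (bigD1 (inord i.-1)) //= inordK // prednK // eqxx mul1r.
    rewrite big1 ?addr0 ?mxE ?inordK // => k /eqP hk.
    case: eqP => [hki|]; last by rewrite mul0r.
    by case: hk; apply/val_inj; rewrite /= inordK // hki.
  rewrite mxE big1 // => k _; case: eqP => [hki|]; last by rewrite mul0r.
  by move: hi; rewrite hki.
have hrow (i : 'I_m.+1) : (0 < i)%N -> row i B = row i Z.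
  move=> hi; rewrite linearB /= rowC hi row_mul !rowY inordK; last first.
    by have := ltn_ord i; lia.
  have -> : (m - i.-1)%N = (m - i).+1 by have := ltn_ord i; lia.
  have him : (m - (m - i))%N = i by have := ltn_ord i; lia.
  by rewrite /= him inord_val addrA addrK addrC subrK.
pose D := B - Z; pose w := row 0 D.
have trD r : \tr (C ^+ r *m D) = 0.
  rewrite mulmxBr !mulmxBr !linearB /= htr !mulmxA.
  have CC : C ^+ r *m C = C *m C ^+ r by rewrite -[LHS]exprSr -[RHS]exprS.
  by rewrite CC [\tr (_ *m Y *m C)]mxtrace_mulC mulmxA !subrr.
have w0 r : (w *m C ^+ r) 0 0 = 0.
  rewrite -[RHS](trD r) mxtrace_mulC /mxtrace (bigD1 0) //= big1 ?addr0.
    by rewrite -row_mul mxE.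
  move=> i hi; have -> : (D *m C ^+ r) i i = (row i D *m C ^+ r) 0 i.
    by rewrite -row_mul [RHS]mxE.
  rewrite linearB /= -hrow ?lt0n // subrr mul0mx mxE //.
have wj (j : nat) r : (j < m.+1)%N -> (w *m C ^+ r) 0 (inord j) = 0.
  elim: j r => [|j IH] r hj.
    by rewrite -[RHS](w0 r); congr (_ _ _); apply/val_inj; rewrite /= inordK.
  have := IH r.+1 (ltnW hj); rewrite exprSr mulmxA mulmx_bidiagonal.
  by rewrite IH ?(ltnW hj) // mul0r add0r inordK ?(ltnW hj) // hj.
apply/eqP; rewrite -subr_eq0 -/D; apply/eqP/row_matrixP => i; rewrite row0.
have [->|hi] := eqVneq i 0; last by rewrite linearB /= hrow ?subrr ?lt0n.
apply/rowP=> j; have := wj j 0%N (ltn_ord j).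
by rewrite expr0 mulmx1 inord_val => ->; rewrite mxE.
Qed.

(** If K were invertible this would be [commutator_bidiagonal] for K^-1 A K. With
    the adjugate in place of the inverse, each of the three uses of
    K^-1 K = 1 costs one factor det K. *)
Lemma commutator_intertwined m (d : nat -> R) (X A K : 'M[R]_m.+1) :
  (forall r, \tr (X ^+ r *m A) = 0) -> X *m K = K *m bidiagonal m d ->
  exists Y, \det K ^+ 3 *: A = X *m Y - Y *m X.
Proof.
set C := bidiagonal m d; set L := \adj K; set e := \det K => htr hXK.
have hKL : K *m L = e%:M by rewrite mul_mx_adj.
have hLK : L *m K = e%:M by rewrite mul_adj_mx.
have hLX : e *: (L *m X) = e *: (C *m L).
  rewrite -mul_mx_scalar -hKL mulmxA -(mulmxA L) hXK !mulmxA hLK.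
  by rewrite -mulmxA mul_scalar_mx.
have hXKr r : X ^+ r *m K = K *m C ^+ r.
  elim: r => [|r IH]; first by rewrite !expr0 mul1mx mulmx1.
  rewrite exprS -[X * _]/(X *m _) -mulmxA IH mulmxA hXK -mulmxA.
  by rewrite exprS.
have [Y hY] : exists Y, L *m A *m K = C *m Y - Y *m C.
  apply: commutator_bidiagonal => r.
  rewrite mxtrace_mulC -!mulmxA -hXKr mulmxA mxtrace_mulC -!mulmxA.
  by rewrite !mulmxA -(mulmxA _ K) hKL mul_mx_scalar -scalemxAl mxtraceZ htr mulr0.
exists (e *: (K *m Y *m L)).
have -> : e ^+ 3 *: A = e *: (K *m (L *m A *m K) *m L).
  rewrite !mulmxA hKL mul_scalar_mx -mulmxA hKL mul_mx_scalar !scalerA.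
  by rewrite !exprS expr0 mulr1 mulrA.
rewrite hY mulmxBr mulmxBl scalerBr !mulmxA -hXK -!mulmxA; congr (_ - _).
  by rewrite -scalemxAr.
by rewrite -scalemxAl -!mulmxA !(scalemxAr _ K) !(scalemxAr _ Y) hLX.
Qed.
End Companion.

(** * The staircase matrix X *)

Section Staircase.
Variable R : comPzRingType.

Lemma sum_shift m (f : nat -> R) (i : 'I_m.+1) s :
  \sum_(k < m.+1) f k *+ (i == k + s :> nat)%N =
    if (s <= i)%N then f (i - s)%N else 0.
Proof.
case: ifP => hs.
  have hi : (i - s < m.+1)%N by have := ltn_ord i; lia.
  rewrite (bigD1 (Ordinal hi)) //= subnK // eqxx mulr1n big1 ?addr0 // => k.
  move=> /eqP hk; case: eqP => [hik|]; last by rewrite mulr0n.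
  by case: hk; apply/val_inj; rewrite /= hik addnK.
rewrite big1 // => k _; case: eqP => [hik|]; last by rewrite mulr0n.
by move: hs; rewrite hik leq_addl.
Qed.

Variables (x : R) (y z : nat -> R).

Definition alternating (j : nat) : R := if odd j then x else 0.

Definition staircase m : 'M[R]_m.+1 := \matrix_(i, j)
  (alternating j *+ (i == j + 0 :> nat)%N + y j *+ (i == j + 1 :> nat)%N
   + z j *+ (i == j + 2 :> nat)%N).

(** The matrix is lower triangular, so it acts on infinite sequences, and the
    action is compatible with truncation. Working with sequences avoids the
    boundary cases at the last row. *)
Definition staircase_act (v : nat -> R) (i : nat) : R :=
  alternating i * v i + if i is i1.+1 then
    y i1 * v i1 + (if i1 is i2.+1 then z i2 * v i2 else 0) else 0.

Lemma staircase_mul_col m (v : nat -> R) :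
  staircase m *m (\col_i v i) = \col_i staircase_act v i.
Proof.
apply/matrixP=> i j; rewrite !mxE.
under eq_bigr do rewrite !mxE !mulrDl !mulrnAl.
rewrite !big_split /= (sum_shift (fun k => _ k * v k))
  (sum_shift (fun k => y k * v k)) (sum_shift (fun k => z k * v k)).
rewrite leq0n subn0 -addrA /staircase_act; congr (_ + _).
by case: (nat_of_ord i) => [|[|k]] //=;
  rewrite ?add0r ?subn0 ?subn1 ?subn2 //= subSS subn0.
Qed.

(** The left-hand side is the entry (j + 2, j) of X^2 - x X. *)
Hypothesis hz :
  forall j, y j * y j.+1 + (if odd j then x else - x) * z j = 1.

Definition supported_from (j : nat) (e : R) (v : nat -> R) :=
  (forall i, (i < j)%N -> v i = 0) /\ v j = e.

Definition staircase_square (v : nat -> R) (i : nat) : R :=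
  staircase_act (staircase_act v) i - x * staircase_act v i.

Lemma staircase_square_low v i : (i < 2)%N -> staircase_square v i = 0.
Proof.
by case: i => [|[|]] // _;
  rewrite /staircase_square /staircase_act /alternating /=; ring.
Qed.

Lemma staircase_squareSS v i : staircase_square v i.+2 =
  v i + if i is i1.+1 then (y i.+1 * z i1 + z i * y i1) * v i1 +
    (if i1 is i2.+1 then z i * z i2 * v i2 else 0) else 0.
Proof.
rewrite -[X in _ = X + _]mul1r -(hz i).
rewrite /staircase_square /staircase_act /alternating.
case: i => [|[|i]] /=; rewrite ?negbK; try ring.
by case: (odd i) => /=; ring.
Qed.

Lemma staircase_square_shift j e v :
  supported_from j e v -> supported_from j.+2 e (staircase_square v).
Proof.
move=> [v0 vj]; split=> [[|[|i]] hi|].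
- exact: staircase_square_low.
- exact: staircase_square_low.
- rewrite staircase_squareSS v0 //.
  case: i hi => [|[|i]] hi; rewrite ?v0 ?mulr0 ?addr0 //; lia.
rewrite staircase_squareSS vj.
case: j v0 {vj} => [|[|j]] v0; rewrite ?v0 ?mulr0 ?addr0 //; lia.
Qed.

Variable c : R.

(** The sequence v, X v, T v, X T v, ... for v = e_0 + c e_1. Alternately
    subtracting 0 and x times the previous vector produces T = X (X - x) every
    second step, and makes the relation X K = K C hold by construction. *)
Fixpoint krylov (k : nat) : nat -> R :=
  if k is k'.+1 then
    fun i => staircase_act (krylov k') i - alternating k' * krylov k' i
  else fun i => (i == 0%N)%:R + c * (i == 1%N)%:R.

Lemma krylovSS k : krylov k.+2 =1 staircase_square (krylov k).
Proof.
move=> i; rewrite /= /staircase_square.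
set v := krylov k.
have -> : staircase_act (fun i => staircase_act v i - alternating k * v i) i =
  staircase_act (staircase_act v) i - alternating k * staircase_act v i.
  by case: i => [|[|i]]; rewrite /staircase_act; ring.
by rewrite /alternating /=; case: (odd k) => /=; ring.
Qed.

Lemma krylov_supported k :
  supported_from k (if odd k then y 0 + c * x else 1) (krylov k).
Proof.
suff: supported_from k (if odd k then y 0 + c * x else 1) (krylov k) /\
  supported_from k.+1 (if odd k.+1 then y 0 + c * x else 1) (krylov k.+1).
  by case.
elim: k => [|k [IH1 IH2]]; last first.
  have [h1 h2] := staircase_square_shift IH1.
  split=> //; split=> [i hi|]; rewrite krylovSS; first exact: h1.
  by rewrite h2 /= negbK.
split; split=> [i|] //=; first by ring.
  by case: i => // _; rewrite /staircase_act /alternating /=; ring.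
by rewrite /staircase_act /alternating /=; ring.
Qed.

Definition krylov_mx m : 'M[R]_m.+1 := \matrix_(i, j) krylov j i.

(** The last column is where the construction could fail; there the next vector
    of the sequence vanishes because it is supported below the matrix. *)
Lemma krylov_intertwines m :
  staircase m *m krylov_mx m = krylov_mx m *m bidiagonal m alternating.
Proof.
apply/matrixP=> i j; rewrite mulmx_bidiagonal.
have -> : (staircase m *m krylov_mx m) i j = staircase_act (krylov j) i.
  have := staircase_mul_col m (krylov j) => /matrixP/(_ i 0).
  by rewrite !mxE => <-; apply: eq_bigr => k _; rewrite !mxE.
rewrite mxE; apply/eqP; rewrite addrC -subr_eq mulrC -/(krylov j.+1 i).
case: ifP => hj; first by rewrite mxE inordK.
have [h _] := krylov_supported j.+1; rewrite h //.
by have := ltn_ord i; have := ltn_ord j; lia.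
Qed.

Lemma det_krylov_mx m :
  exists k, \det (krylov_mx m) = (y 0 + c * x) ^+ k.
Proof.
rewrite det_trig; last first.
  apply/is_trig_mxP=> i j hij; rewrite mxE.
  by have [h _] := krylov_supported j; apply: h.
exists #|[pred i : 'I_m.+1 | odd i]|.
rewrite -prodr_const [RHS]big_mkcond /=; apply: eq_bigr => i _.
by rewrite mxE; have [_ ->] := krylov_supported i.
Qed.

End Staircase.

Section StaircaseCommutator.
Variable R : comPzRingType.
Variables (x : R) (y z : nat -> R).
Hypothesis hz :
  forall j, y j * y j.+1 + (if odd j then x else - x) * z j = 1.

(** The multiples r A that are of the form [X, Y] for fixed X form an ideal of
    multipliers r; it contains powers of the comaximal elements y_0 and
    y_0 + x. *)
Lemma staircase_commutator m (A : 'M[R]_m.+1) :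
  (forall r, \tr (staircase x y z m ^+ r *m A) = 0) ->
  exists Y, A = staircase x y z m *m Y - Y *m staircase x y z m.
Proof.
set X := staircase x y z m => htr.
have step c : exists k Y, (y 0 + c * x) ^+ k *: A = X *m Y - Y *m X.
  have [Y hY] := commutator_intertwined htr (krylov_intertwines hz c m).
  have [k hk] := det_krylov_mx hz c m.
  by exists (k * 3)%N, Y; rewrite exprM -hk.
have [k [Y hY]] := step 0; have [l [Z hZ]] := step 1.
have [u [v huv]] : comaximal ((y 0 + 0 * x) ^+ k) ((y 0 + 1 * x) ^+ l).
  apply/comaximalXr/comaximal_sym/comaximalXr.
  (* y_0 (y_1 + z_0) - (y_0 + x) z_0 = 1 is the tuning equation for j = 0 *)
  by exists (- z 0), (y 1 + z 0); rewrite -[RHS](hz 0) /=; ring.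
exists (u *: Y + v *: Z).
rewrite -[LHS]scale1r -huv scalerDl -!scalerA hY hZ.
rewrite mulmxDr mulmxDl -!scalemxAr -!scalemxAl !scalerBr opprD.
by rewrite addrACA.
Qed.

(** The sum selects the entry (i, i + 1), and is 0 when i is the last index. *)
Definition superdiag m (A : 'M[R]_m.+1) (i : 'I_m.+1) : R :=
  \sum_(k < m.+1) A i k *+ (k == i + 1 :> nat)%N.

Definition hessenberg m (A : 'M[R]_m.+1) :=
  forall i j : 'I_m.+1, (i.+1 < j)%N -> A i j = 0.

Lemma mxtrace_mul_hessenberg m (M A : 'M[R]_m.+1) : hessenberg A ->
  (forall i j : 'I_m.+1, (i < j.+2)%N -> M i j = 0) -> \tr (M *m A) = 0.
Proof.
move=> hA hM; rewrite /mxtrace big1 // => i _; rewrite mxE big1 // => k _.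
have [hik|hik] := ltnP i k.+2; first by rewrite hM ?mul0r.
by rewrite hA ?mulr0.
Qed.

(** The hypothesis on the sums says tr (X A) = 0. Higher powers of X
    contribute nothing new, by X^(r+2) = x X^(r+1) + X^r T. *)
Lemma hessenberg_staircase_commutator m (A : 'M[R]_m.+1) : hessenberg A ->
  \tr A = 0 ->
  x * (\sum_(i < m.+1 | odd i) A i i) + \sum_(i < m.+1) y i * superdiag A i = 0 ->
  exists Y, A = staircase x y z m *m Y - Y *m staircase x y z m.
Proof.
move=> hA htr0 hlin; apply: staircase_commutator.
set X := staircase x y z m.
have htr1 : \tr (X *m A) = 0.
  rewrite mxtrace_mulC -[RHS]hlin mulr_sumr [X in X + _]big_mkcond -big_split.
  apply: eq_bigr => i _ /=; rewrite mxE.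
  under eq_bigr do rewrite mxE !mulrDr.
  rewrite !big_split /= [X in _ + X]big1 ?addr0; last first.
    move=> k _; case: eqP => [hk|]; last by rewrite mulr0n mulr0.
    by rewrite hA ?mul0r // hk; lia.
  congr (_ + _); last first.
    rewrite mulr_sumr; apply: eq_bigr => k _.
    by rewrite !mulrnAr mulrC.
  rewrite (bigD1 i) //= addn0 eqxx mulr1n big1 ?addr0; last first.
    move=> k hk; case: eqP => [hki|]; last by rewrite mulr0n mulr0.
    by case/eqP: hk; apply/val_inj; rewrite /= hki.
  by rewrite mulrC /alternating; case: odd; rewrite ?mul0r.
pose T : 'M[R]_m.+1 := X *m X - x *: X.
have hT (i j : 'I_m.+1) : (i < j.+2)%N -> T i j = 0.
  move=> hij; pose e (k : nat) : R := (k == j :> nat)%:R.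
  have hcol : delta_mx j 0 = \col_i e i :> 'cV[R]_m.+1.
    by apply/matrixP=> k l; rewrite !mxE ord1 andbT.
  have -> : T i j = (T *m delta_mx j (0 : 'I_1)) i 0.
    by have := colE j T => /matrixP/(_ i 0); rewrite [LHS]mxE.
  rewrite mulmxBl -mulmxA -scalemxAl hcol !staircase_mul_col !mxE.
  rewrite -/(staircase_square x y z e i).
  have [|h _] := staircase_square_shift hz (j := j) (e := 1) (v := e).
    by split=> [k hk|]; rewrite /e ?eqxx // ltn_eqF.
  exact: h.
have hlow r (i j : 'I_m.+1) : (i < j.+2)%N -> (X ^+ r *m T) i j = 0.
  elim: r i => [|r IH] i hij; first by rewrite expr0 mul1mx hT.
  rewrite exprS -[X * _]/(X *m _) -mulmxA mxE big1 // => k _.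
  have [hik|hki] := ltnP i k; last by rewrite IH ?mulr0 // (leq_ltn_trans hki).
  rewrite mxE; do 3!(case: eqP; [lia|move=> _]).
  by rewrite !addr0 mul0r.
have htrS r : \tr (X ^+ r.+1 *m A) = 0.
  elim: r => [|r IH]; first by rewrite expr1.
  have -> : X ^+ r.+2 = x *: X ^+ r.+1 + X ^+ r *m T.
    rewrite mulmxBr -scalemxAr mulmxA -[X in _ + (_ - X)]/(x *: (X ^+ r * X)).
    rewrite -[X ^+ r *m X]/(X ^+ r * X) -exprSr addrC subrK.
    by rewrite -[_ *m X]/(_ * X) -exprSr.
  rewrite mulmxDl linearD /= -scalemxAl linearZ /= IH mulr0 add0r.
  by apply: mxtrace_mul_hessenberg => // i j; apply: hlow.
by case=> [|r]; rewrite ?expr0 ?mul1mx.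
Qed.

End StaircaseCommutator.

(** * Reduction to Hessenberg form *)

Section Reduction.
Variable R : comPzRingType.
Hypothesis hR : principal_ideal_ring R.

Lemma row_reduction m (u : 'rV[R]_(1 + m)) : exists g (P Q : 'M[R]_(1 + m)),
  [/\ P *m Q = 1%:M, Q *m P = 1%:M & u *m P = row_mx g%:M 0].
Proof.
elim: m u => [|m IH] u.
  exists (lsubmx u 0 0), 1%:M, 1%:M; rewrite !mulmx1; split=> //.
  by rewrite -{1}[u]hsubmxK [rsubmx u]thinmx0 -mx11_scalar.
rewrite -[u]hsubmxK [lsubmx u]mx11_scalar; set a := lsubmx u 0 0.
have [g [P [Q [hPQ hQP hv]]]] := IH (rsubmx u).
have [d [a' [b' [ha hb [p [q hpq]]]]]] := gcd_cofactors hR a g.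
have simp := (mulmx0, mul0mx, addr0, add0r, mulmx1, mul1mx).
pose B (x1 x2 x3 x4 : R) : 'M[R]_(1 + (1 + m)) :=
  block_mx x1%:M (row_mx x2%:M 0) (col_mx x3%:M 0) (block_mx x4%:M 0 0 1%:M).
have B1 : B 1 0 0 1 = 1%:M.
  by rewrite /B raddf0 row_mx0 col_mx0 -!scalar_mx_block.
have Beq x1 x2 x3 x4 y1 y2 y3 y4 : x1 = y1 -> x2 = y2 -> x3 = y3 ->
    x4 = y4 -> B x1 x2 x3 x4 = B y1 y2 y3 y4 by move=> -> -> -> ->.
have BM x1 x2 x3 x4 y1 y2 y3 y4 : B x1 x2 x3 x4 *m B y1 y2 y3 y4 =
    B (x1 * y1 + x2 * y3) (x1 * y2 + x2 * y4)
      (x3 * y1 + x4 * y3) (x3 * y2 + x4 * y4).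
  rewrite /B mulmx_block mul_row_col mul_mx_row mul_row_block mul_col_mx.
  rewrite mul_block_col mul_col_row mulmx_block.
  rewrite !simp add_row_mx add_col_mx add_block_mx !simp -!scalar_mxM.
  by rewrite -!raddfD.
have rowB r1 r2 x1 x2 x3 x4 :
    row_mx r1%:M (row_mx r2%:M 0) *m B x1 x2 x3 x4 =
    row_mx (r1 * x1 + r2 * x3)%:M (row_mx (r1 * x2 + r2 * x4)%:M 0)
      :> 'rV[R]_(1 + (1 + m)).
  rewrite /B mul_row_block mul_row_col mul_mx_row mul_row_block.
  by rewrite !simp -!scalar_mxM add_row_mx addr0 -!raddfD.
pose D (M : 'M[R]_(1 + m)) : 'M[R]_(1 + (1 + m)) := block_mx 1%:M 0 0 M.
have DM M N : D M *m D N = D (M *m N) by rewrite /D mulmx_block !simp.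
have D1 : D 1%:M = 1%:M by rewrite /D -scalar_mx_block.
exists d, (D P *m B p (- b') q a'), (B a' b' (- q) p *m D Q); split.
- rewrite !mulmxA -(mulmxA (D P)) BM.
  rewrite (_ : B _ _ _ _ = 1%:M) ?mulmx1 ?DM ?hPQ ?D1 // -B1.
  by apply: Beq; rewrite -?hpq; ring.
- rewrite !mulmxA -(mulmxA (B _ _ _ _)) DM hQP D1 mulmx1 BM -B1.
  by apply: Beq; rewrite -?hpq; ring.
rewrite mulmxA /D mul_row_block !simp hv [LHS]rowB.
have -> : a * p + g * q = d by rewrite -[RHS]mulr1 -hpq ha hb; ring.
have -> : a * - b' + g * a' = 0 by rewrite ha hb; ring.
by rewrite raddf0 row_mx0.
Qed.

(** Both c and w come from an invertible matrix that clears the row u: c is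
    the first row of its inverse, and w the first column of the matrix itself. *)
Lemma common_factor_vector m (u : 'I_m.+1 -> R) : exists g (c w : 'I_m.+1 -> R),
  (forall i, u i = g * c i) /\ \sum_i c i * w i = 1.
Proof.
have [g [P [Q [hPQ hQP hu]]]] := @row_reduction m (\row_i u i).
exists g, (fun i => Q 0 i), (fun i => P i 0); split=> [i|]; last first.
  by have /matrixP/(_ 0 0) := hQP; rewrite !mxE.
have : \row_i u i = row_mx g%:M 0 *m Q :> 'rV[R]_(1 + m).
  by rewrite -hu -mulmxA hPQ mulmx1.
have -> : row_mx g%:M 0 = g *: delta_mx 0 0 :> 'rV[R]_(1 + m).
  apply/rowP=> j; rewrite !mxE eqxx -(val_eqE j) /=.
  by case: splitP => k ->; rewrite !mxE ?ord1 /= ?eqxx ?mulr1 ?mulr0.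
by rewrite -scalemxAl -rowE => /rowP/(_ i); rewrite !mxE.
Qed.

(** Clear the first row with a change of the remaining basis vectors, then recurse
    on the lower right block. The clause that P fixes the first coordinate
    makes the induction work: it keeps the cleared first row intact. *)
Lemma hessenberg_reduction m (A : 'M[R]_(1 + m)) : exists P Q : 'M[R]_(1 + m),
  [/\ P *m Q = 1%:M, Q *m P = 1%:M,
      row_mx 1%:M 0 *m P = row_mx 1%:M 0 :> 'rV[R]_(1 + m)
    & hessenberg (Q *m A *m P)].
Proof.
have simp := (mulmx0, mul0mx, addr0, add0r, mulmx1, mul1mx).
elim: m A => [|m IH] A.
  by exists 1%:M, 1%:M; rewrite !mulmx1; split=> // i j; rewrite !ord1.
rewrite -[A]submxK; set u := ursubmx A.
have [g [P1 [Q1 [hPQ1 hQP1 hu]]]] := row_reduction u.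
have [P2 [Q2 [hPQ2 hQP2 he hH]]] := IH (Q1 *m drsubmx A *m P1).
pose D (M : 'M[R]_(1 + m)) : 'M[R]_(1 + (1 + m)) := block_mx 1%:M 0 0 M.
have DM M N : D M *m D N = D (M *m N) by rewrite /D mulmx_block !simp.
have D1 : D 1%:M = 1%:M by rewrite /D -scalar_mx_block.
exists (D (P1 *m P2)), (D (Q2 *m Q1)); split.
- by rewrite DM mulmxA -(mulmxA P1) hPQ2 mulmx1 hPQ1.
- by rewrite DM mulmxA -(mulmxA Q2) hQP1 mulmx1 hQP2.
- by rewrite /D mul_row_block !simp.
rewrite /D !mulmx_block !simp.
have -> : u *m (P1 *m P2) = row_mx g%:M 0.
  rewrite mulmxA hu.
  have -> : row_mx g%:M 0 = g *: row_mx 1%:M 0 :> 'rV[R]_(1 + m).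
    by rewrite scale_row_mx scaler0 scalemx1.
  by rewrite -scalemxAl he.
have -> : Q2 *m Q1 *m drsubmx A *m (P1 *m P2) =
  Q2 *m (Q1 *m drsubmx A *m P1) *m P2 by rewrite !mulmxA.
move=> i j.
case: (@split_ordP 1 (1 + m) i) => i1 ->; case: (@split_ordP 1 (1 + m) j) => j1 ->.
- by rewrite !ord1.
- rewrite ord1 => hij; etransitivity; first exact: block_mxEur.
  move: hij; case: (@split_ordP 1 m j1) => k ->; first by rewrite ord1.
  by move=> _; etransitivity; [exact: row_mxEr | rewrite mxE].
- by rewrite ord1 /=; lia.
- move=> hij; etransitivity; first exact: block_mxEdr.
  by apply: hH; move: hij; rewrite /= -addnS ltn_add2l.
Qed.

End Reduction.

Lemma trace_zero_commutator (R : comPzRingType) (hR : principal_ideal_ring R)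
  m (A : 'M[R]_m.+1) : \tr A = 0 ->
  exists X Y : 'M[R]_m.+1, A = X *m Y - Y *m X.
Proof.
move=> htrA.
have [P [Q [hPQ hQP _ hH]]] := hessenberg_reduction hR (A : 'M_(1 + m)).
set B := Q *m A *m P in hH.
suff [X [Y hXY]] : exists X Y : 'M[R]_m.+1, B = X *m Y - Y *m X.
  exists (P *m X *m Q), (P *m Y *m Q).
  have conjM (X' Y' : 'M[R]_m.+1) :
      P *m X' *m Q *m (P *m Y' *m Q) = P *m (X' *m Y') *m Q.
    by rewrite !mulmxA -(mulmxA _ Q) hQP mulmx1.
  rewrite !conjM -mulmxBl -mulmxBr -hXY /B !mulmxA hPQ mul1mx.
  by rewrite -mulmxA hPQ mulmx1.
have htrB : \tr B = 0 by rewrite mxtrace_mulC mulmxA hPQ mul1mx.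
have [g [c [w [hc hcw]]]] := common_factor_vector hR (superdiag B).
pose t := \sum_(i < m.+1 | odd i) B i i.
have [h [t0 [b0 [ht hg hco]]]] := gcd_cofactors hR t g.
have [x0 [u [u' [s [k [huu hbal]]]]]] :=
  balanced_comaximal hR (\sum_(i < m.+1 | ~~ odd i) c i)
    (\sum_(i < m.+1 | odd i) c i) hco.
(* the multiple k of x is spread over the subdiagonal with the weights w, so
   that it contributes x k times the sum of the c i * w i, which is 1 *)
pose x := b0 * x0.
pose f j := if odd j then u else u'.
pose y (j : nat) := f j + x * k * w (inord j).
pose z (j : nat) := (if odd j then -1 else 1) *
  (s + k * (w (inord j) * f j.+1 + w (inord j.+1) * f j)
     + x * k ^+ 2 * w (inord j) * w (inord j.+1)).
have hz j : y j * y j.+1 + (if odd j then x else - x) * z j = 1.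
  have hf : f j * f j.+1 = 1 + x * s.
    by rewrite /f /= -huu; case: (odd j); rewrite //= mulrC.
  have -> : (if odd j then x else - x) * z j = - x *
    (s + k * (w (inord j) * f j.+1 + w (inord j.+1) * f j)
     + x * k ^+ 2 * w (inord j) * w (inord j.+1)).
    by rewrite /z; case: (odd j); ring.
  by rewrite /y; ring: hf.
exists (staircase x y z m).
apply: hessenberg_staircase_commutator => //.
rewrite -/t ht.
have -> : \sum_(i < m.+1) y i * superdiag B i =
    g * (\sum_(i < m.+1) f i * c i + x * k * \sum_i c i * w i).
  rewrite mulrDr !mulr_sumr -big_split; apply: eq_bigr => i _ /=.
  by rewrite /y hc inord_val; ring.
have -> : \sum_(i < m.+1) f i * c i =
   u' * \sum_(i < m.+1 | ~~ odd i) c i + u * \sum_(i < m.+1 | odd i) c i.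
  rewrite (bigID (fun i : 'I_m.+1 => odd i)) /= addrC !mulr_sumr.
  by congr (_ + _); apply: eq_bigr => i hi; rewrite /f ?(negbTE hi) ?hi.
rewrite hcw hg /x; set S0 := \sum_(i | ~~ _) _; set S1 := \sum_(i | _) _.
have -> : b0 * x0 * (h * t0) + h * b0 * (u' * S0 + u * S1 + b0 * x0 * k * 1) =
  h * b0 * (x0 * (t0 + b0 * k) + u' * S0 + u * S1) by ring.
by rewrite hbal mulr0.
Qed.

Theorem corollary6p4 (R : comPzRingType) (hR : principal_ideal_ring R)
  (n : nat) (hn : (2 <= n)%N) (A : 'M[R]_n) (hA : \tr A = 0) :
  exists X Y : 'M[R]_n, A = X *m Y - Y *m X.
Proof.
by case: n hn A hA => // m _ A; apply: trace_zero_commutator.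
Qed.
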